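(* Let $n\geq 1$ be a natural number, and let $L(m)$ denote the number of lattices with $m$ elements, up to isomorphism. Then there exist at least $L(n+1)$ common meadows with $2n+1$ elements, up to isomorphism (i.e. at least $L(n+1)$ pairwise non-isomorphic ones).
   Context: A pre-meadow is a structure $(P,+,-,\cdot)$ with two binary operations $+,\cdot$, a unary operation $-$ and constants $0,1$, satisfying for all $x,y,z\in P$: $(x+y)+z=x+(y+z)$; $x+y=y+x$; $x+0=x$; $x+(-x)=0\cdot x$; $(x\cdot y)\cdot z=x\cdot(y\cdot z)$; $x\cdot y=y\cdot x$; $1\cdot x=x$; $x\cdot(y+z)=x\cdot y+x\cdot z$; $-(-x)=x$; $0\cdot(x+y)=0\cdot x+0\cdot y$. For a pre-meadow $P$, let $0\cdot P=\{0\cdot x\mid x\in P\}$ and, for $z\in 0\cdot P$, let $P_z=\{x\in P\mid 0\cdot x=z\}$. $P$ is a pre-meadow with $\mathbf{a}$ if there exists a unique $z\in 0\cdot P$ with $|P_z|=1$, this $z$ being denoted $\mathbf{a}$, and moreover $x+\mathbf{a}=\mathbf{a}$ for all $x\in P$. A common meadow is a pre-meadow with $\mathbf{a}$, $M$, equipped with a (total) inverse function $(\cdot)^{-1}:M\to M$ such that for all $x,y\in M$: $x\cdot x^{-1}=1+0\cdot x^{-1}$; $(x\cdot y)^{-1}=x^{-1}\cdot y^{-1}$; $(1+0\cdot x)^{-1}=1+0\cdot x$; $0^{-1}=\mathbf{a}$. An isomorphism of common meadows is a bijection preserving $0$, $1$, $+$, $\cdot$, $-$ and $(\cdot)^{-1}$.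 *)

(* Defs.v *)
From HB Require Import structures.
From mathcomp Require Import all_boot all_order fingroup perm.

Set Implicit Arguments.
Unset Strict Implicit.
Unset Printing Implicit Defensive.

Import Order.TTheory.

(* A lattice structure on 'I_m is encoded by the graph r : {set 'I_m * 'I_m} of
   its order, (x, y) \in r meaning x <= y.  The lemmas lattice_order_of and
   lattice_order_realized relate these graphs to the library's lattices. *)

Section LatticeCount.
Variable m : nat.
Implicit Types r : {set 'I_m * 'I_m}.

Definition rle r : rel 'I_m := fun x y => (x, y) \in r.

Definition is_partial_order r : bool :=
  [&& [forall x, rle r x x],
      [forall x, forall y, (rle r x y && rle r y x) ==> (x == y)] &
      [forall x, forall y, forall z,
         (rle r x y && rle r y z) ==> rle r x z]].

Definition is_meet r (x y z : 'I_m) : bool :=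
  [forall t, rle r t z == (rle r t x && rle r t y)].

Definition is_join r (x y z : 'I_m) : bool :=
  [forall t, rle r z t == (rle r x t && rle r y t)].

Definition is_lattice_order r : bool :=
  [&& is_partial_order r,
      [forall x, forall y, exists z, is_meet r x y z] &
      [forall x, forall y, exists z, is_join r x y z]].

Definition lattice_orders : {set {set 'I_m * 'I_m}} :=
  [set r | is_lattice_order r].

Definition lattice_iso : rel {set 'I_m * 'I_m} := fun r1 r2 =>
  [exists s : {perm 'I_m},
     [forall x, forall y, rle r2 (s x) (s y) == rle r1 x y]].

Definition num_lattices : nat :=
  #|equivalence_partition lattice_iso lattice_orders|.

Lemma lattice_isoP r1 r2 :
  reflect (exists s : {perm 'I_m}, forall x y, rle r2 (s x) (s y) = rle r1 x y)
          (lattice_iso r1 r2).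
Proof.
apply: (iffP existsP) => -[s Hs]; exists s.
  by move=> x y; apply/eqP; move/forallP/(_ x)/forallP: Hs; apply.
by apply/forallP=> x; apply/forallP=> y; rewrite Hs.
Qed.

Lemma lattice_iso_equivalence : {in lattice_orders & &, equivalence_rel lattice_iso}.
Proof.
have refl r : lattice_iso r r.
  by apply/lattice_isoP; exists 1%g => x y; rewrite !perm1.
have sym r1 r2 : lattice_iso r1 r2 -> lattice_iso r2 r1.
  case/lattice_isoP=> s Hs; apply/lattice_isoP; exists (s^-1)%g => x y.
  by rewrite -Hs !permKV.
have trans r1 r2 r3 : lattice_iso r1 r2 -> lattice_iso r2 r3 -> lattice_iso r1 r3.
  case/lattice_isoP=> s Hs /lattice_isoP [t Ht]; apply/lattice_isoP.
  by exists (s * t)%g => x y; rewrite !permM Ht Hs.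
move=> r1 r2 r3 _ _ _; split=> // H12; apply/idP/idP; last exact: trans.
by apply: trans; apply: sym.
Qed.

Lemma is_lattice_orderP r :
  reflect [/\ reflexive (rle r), antisymmetric (rle r), transitive (rle r),
              forall x y, exists z, forall t, rle r t z = rle r t x && rle r t y
            & forall x y, exists z, forall t, rle r z t = rle r x t && rle r y t]
          (is_lattice_order r).
Proof.
apply: (iffP and3P).
  case=> /and3P[/forallP H1 H2 H3] H4 H5; split=> //.
  - move=> x y H; apply/eqP.
    by move/forallP/(_ x)/forallP/(_ y)/implyP: H2; apply.
  - move=> y x z H H'.
    move/forallP/(_ x)/forallP/(_ y)/forallP/(_ z)/implyP: H3; apply.
    by rewrite H.
  - move=> x y; move/forallP/(_ x)/forallP/(_ y)/existsP: H4 => [z /forallP Hz].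
    by exists z => t; apply/eqP.
  - move=> x y; move/forallP/(_ x)/forallP/(_ y)/existsP: H5 => [z /forallP Hz].
    by exists z => t; apply/eqP.
case=> H1 H2 H3 H4 H5; split.
- apply/and3P; split.
  + exact/forallP.
  + by apply/forallP=> x; apply/forallP=> y; apply/implyP=> /H2 ->.
  + apply/forallP=> x; apply/forallP=> y; apply/forallP=> z.
    by apply/implyP=> /andP[Hxy]; apply: H3.
- apply/forallP=> x; apply/forallP=> y; apply/existsP; have [z Hz] := H4 x y.
  by exists z; apply/forallP=> t; apply/eqP.
- apply/forallP=> x; apply/forallP=> y; apply/existsP; have [z Hz] := H5 x y.
  by exists z; apply/forallP=> t; apply/eqP.
Qed.

End LatticeCount.

Lemma lattice_order_of d (T : finLatticeType d) :
  exists2 r : {set 'I_#|T| * 'I_#|T|}, r \in lattice_orders #|T| &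
    forall x y : T, rle r (enum_rank x) (enum_rank y) = (x <= y)%O.
Proof.
pose r := [set p : 'I_#|T| * 'I_#|T| | (enum_val p.1 <= enum_val p.2 :> T)%O].
have rE i j : rle r i j = (enum_val i <= enum_val j :> T)%O.
  by rewrite /rle inE.
exists r => [|x y]; last by rewrite rE !enum_rankK.
rewrite inE; apply/is_lattice_orderP; split.
- by move=> i; rewrite rE lexx.
- move=> i j; rewrite !rE => /le_anti; exact: enum_val_inj.
- by move=> j i k; rewrite !rE; apply: le_trans.
- move=> i j; exists (enum_rank (Order.meet (enum_val i) (enum_val j))) => t.
  by rewrite !rE enum_rankK lexI.
- move=> i j; exists (enum_rank (Order.join (enum_val i) (enum_val j))) => t.
  by rewrite !rE enum_rankK leUx.
Qed.

Lemma finLattice_of_rel (X : finType) (le : rel X) :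
  reflexive le -> antisymmetric le -> transitive le ->
  (forall x y, exists z, forall t, le t z = le t x && le t y) ->
  (forall x y, exists z, forall t, le z t = le x t && le y t) ->
  exists (d : Order.disp_t) (T : finLatticeType d) (f : T -> X),
    bijective f /\ forall x y, le (f x) (f y) = (x <= y)%O.
Proof.
move=> lexx' leanti letrans lemeet lejoin.
have meetE x y : exists z, [forall t, le t z == le t x && le t y].
  by have [z Hz] := lemeet x y; exists z; apply/forallP=> t; apply/eqP.
have joinE x y : exists z, [forall t, le z t == le x t && le y t].
  by have [z Hz] := lejoin x y; exists z; apply/forallP=> t; apply/eqP.
pose d := Order.Disp tt tt.
pose pmix := @Order.Le_isPOrder.Build d X le lexx' leanti letrans.
pose P : finPOrderType d := HB.pack (Finite.sort X) pmix.
pose mt (x y : P) : P := xchoose (meetE x y).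
pose jn (x y : P) : P := xchoose (joinE x y).
have mtP (x y z : P) : (x <= mt y z)%O = (x <= y)%O && (x <= z)%O.
  by have /forallP/(_ x)/eqP := xchooseP (meetE y z).
have jnP (x y z : P) : (jn x y <= z)%O = (x <= z)%O && (y <= z)%O.
  by have /forallP/(_ z)/eqP := xchooseP (joinE x y).
pose lmix := @Order.POrder_MeetJoin_isLattice.Build d P mt jn mtP jnP.
pose T : finLatticeType d := HB.pack (Order.FinPOrder.sort P) lmix.
by exists d, T, id; split=> //; exists id.
Qed.

Lemma lattice_order_realized m (r : {set 'I_m * 'I_m}) :
  r \in lattice_orders m ->
  exists (d : Order.disp_t) (T : finLatticeType d) (f : T -> 'I_m),
    bijective f /\ forall x y, rle r (f x) (f y) = (x <= y)%O.
Proof. by rewrite inE => /is_lattice_orderP[]; apply: finLattice_of_rel. Qed.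

Declare Scope meadow_scope.
Delimit Scope meadow_scope with mdw.
Local Open Scope meadow_scope.

HB.mixin Record isPreMeadow P := {
  madd : P -> P -> P;
  mopp : P -> P;
  mmul : P -> P -> P;
  mzero : P;
  mone : P;
  maddA : forall x y z, madd (madd x y) z = madd x (madd y z);
  maddC : forall x y, madd x y = madd y x;
  maddr0 : forall x, madd x mzero = x;
  maddrN : forall x, madd x (mopp x) = mmul mzero x;
  mmulA : forall x y z, mmul (mmul x y) z = mmul x (mmul y z);
  mmulC : forall x y, mmul x y = mmul y x;
  mmul1r : forall x, mmul mone x = x;
  mmulDr : forall x y z, mmul x (madd y z) = madd (mmul x y) (mmul x z);
  moppK : forall x, mopp (mopp x) = x;
  mmul0D : forall x y,
    mmul mzero (madd x y) = madd (mmul mzero x) (mmul mzero y)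
}.

#[short(type="preMeadowType")]
HB.structure Definition PreMeadow := {P of isPreMeadow P}.

Notation "0" := mzero : meadow_scope.
Notation "1" := mone : meadow_scope.
Notation "x + y" := (madd x y) : meadow_scope.
Notation "x * y" := (mmul x y) : meadow_scope.
Notation "- x" := (mopp x) : meadow_scope.

Definition in_zeroP (P : preMeadowType) (z : P) : Prop := exists x : P, z = 0 * x.

Definition fibre (P : preMeadowType) (z : P) : P -> Prop := fun x => 0 * x = z.

Definition singleton_fibre (P : preMeadowType) (z : P) : Prop :=
  exists! x : P, fibre z x.

(* The element a is a field, but it is determined by mbot_unique. *)
HB.mixin Record PreMeadow_hasBot P of PreMeadow P := {
  mbot : P;
  mbot_unique : unique (fun z : P => in_zeroP z /\ singleton_fibre z) mbot;
  maddr_bot : forall x : P, x + mbot = mbot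
}.

#[short(type="preMeadowBotType")]
HB.structure Definition PreMeadowBot := {P of PreMeadow P & PreMeadow_hasBot P}.

HB.mixin Record PreMeadowBot_isCommonMeadow M of PreMeadowBot M := {
  minv : M -> M;
  mmulrV : forall x : M, x * minv x = 1 + 0 * minv x;
  minvM : forall x y : M, minv (x * y) = minv x * minv y;
  minv1D0 : forall x : M, minv (1 + 0 * x) = 1 + 0 * x;
  minv0 : minv 0 = mbot
}.

#[short(type="commonMeadowType")]
HB.structure Definition CommonMeadow :=
  {M of PreMeadowBot M & PreMeadowBot_isCommonMeadow M}.

#[short(type="finCommonMeadowType")]
HB.structure Definition FinCommonMeadow := {M of Finite M & CommonMeadow M}.

Notation "x ^-1" := (minv x) : meadow_scope.

Definition is_meadow_iso (M N : commonMeadowType) (f : M -> N) : Prop :=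
  bijective f /\
  [/\ f 0 = 0 & f 1 = 1] /\
  [/\ {morph f : x y / x + y}, {morph f : x y / x * y},
      {morph f : x / - x} & {morph f : x / x^-1}].

Definition meadow_isomorphic (M N : commonMeadowType) : Prop :=
  exists f : M -> N, is_meadow_iso f.

(* Main.v *)
Require Import Defs.
From HB Require Import structures.
From mathcomp Require Import all_boot all_order perm.

Set Implicit Arguments.
Unset Strict Implicit.
Unset Printing Implicit Defensive.

Import Order.TTheory.

(** Let [L] be a finite lattice; it has a bottom and a top.  Put a
    copy of the field with two elements at every [l] other than the bottom, the
    trivial ring at the bottom, and as transition maps along [l >= m] the
    identity, or the map to the trivial ring when [m] is the bottom.  On the
    disjoint union, operands are moved down to the meet of their levels before
    they are added or multiplied.  This gives a pre-meadow with zero at the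
    top level and with the single element of the bottom level as the absorbing
    element; the nonzero element of each field is its own inverse and every zero
    has the absorbing element as inverse ([bit_meadow]).  With [n.+1] levels
    there are [2 * n + 1] elements ([card_bit_meadow]).

    The lattice can be read off the meadow: the elements [0 * x] are the zeros
    of the levels, and adding two of them takes the meet of the levels.  So an
    isomorphism of meadows induces a bijection of the lattices that preserves
    meets, hence the order ([bit_meadow_iso]).  Choosing one lattice in each
    isomorphism class ([lattice_representatives]) therefore gives pairwise
    non-isomorphic meadows. *)

(** * The common meadow of a finite lattice *)

Section BitMeadow.
Variables (d : Order.disp_t) (L : finTBLatticeType d).
Local Open Scope meadow_scope.

(** The trivial ring at the bottom is obtained by excluding the pair
    [(\bot, true)]; elsewhere the boolean is an element of the two-element
    field, with [addb] and [andb] as operations. *)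
Definition bit_meadow := {p : L * bool | p.2 ==> (p.1 != \bot)%O}.

HB.instance Definition _ := Finite.on bit_meadow.

Implicit Types (x y z : bit_meadow) (l m : L).

Definition level x : L := (val x).1.
Definition bit x : bool := (val x).2.

Fact elt_subproof l b : (b && (l != \bot)%O) ==> (l != \bot)%O.
Proof. by apply/implyP => /andP[]. Qed.

(** This is the map from the two-element field onto the ring at [l]: it erases
    the bit when [l] is the bottom.  Building all operations with
    it makes the constraint of [bit_meadow] automatic. *)
Definition elt l b : bit_meadow := Sub (l, b && (l != \bot)%O) (elt_subproof l b).

Lemma level_elt l b : level (elt l b) = l.
Proof. by rewrite /level SubK. Qed.

Lemma bit_elt l b : bit (elt l b) = b && (l != \bot)%O.
Proof. by rewrite /bit SubK. Qed.

Lemma eltK x : elt (level x) (bit x) = x.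
Proof.
apply: val_inj; rewrite SubK /bit /level.
by case: x => -[l b] /=; case: b => //= ->.
Qed.

(** Equality of bits only matters away from the bottom level.  In the axioms
    below this removes the erasures performed at intermediate meets, because a
    meet other than the bottom has no bottom among its arguments. *)
Lemma eq_elt l l' b b' :
  l = l' -> (l != \bot%O -> b = b') -> elt l b = elt l' b'.
Proof.
move=> <- bb; apply: val_inj; rewrite !SubK; congr (_, _).
by case: eqP bb => [|_ ->]; rewrite ?andbF.
Qed.

Lemma meet_neq_bot l m :
  (Order.meet l m != \bot)%O -> (l != \bot)%O /\ (m != \bot)%O.
Proof.
by move=> lm; split; apply: contraNneq lm => ->; rewrite ?meet0x ?meetx0.
Qed.

Lemma top_neq_bot l : (l != \bot)%O -> (\top != \bot :> L)%O.
Proof. by apply: contraNneq => top0; rewrite -[l]meet1x top0 meet0x. Qed.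

Definition bmadd x y := elt (Order.meet (level x) (level y)) (bit x (+) bit y).
Definition bmmul x y := elt (Order.meet (level x) (level y)) (bit x && bit y).
Definition bmzero := elt \top%O false.
Definition bmone := elt \top%O true.

Lemma bmaddA x y z : bmadd (bmadd x y) z = bmadd x (bmadd y z).
Proof.
apply: eq_elt; rewrite !level_elt ?meetA // => xyz; rewrite !bit_elt.
have [-> _] := meet_neq_bot xyz.
by move: xyz; rewrite -meetA => /meet_neq_bot[_ ->]; rewrite !andbT addbA.
Qed.

Lemma bmaddC x y : bmadd x y = bmadd y x.
Proof. by rewrite /bmadd meetC addbC. Qed.

Lemma bmaddr0 x : bmadd x bmzero = x.
Proof. by rewrite /bmadd level_elt bit_elt meetx1 addbF eltK. Qed.

(** Each ring has characteristic two, so that the identity is the opposite. *)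
Lemma bmaddrN x : bmadd x x = bmmul bmzero x.
Proof. by rewrite /bmadd /bmmul level_elt bit_elt meetxx meet1x addbb. Qed.

Lemma bmmulA x y z : bmmul (bmmul x y) z = bmmul x (bmmul y z).
Proof.
apply: eq_elt; rewrite !level_elt ?meetA // => xyz; rewrite !bit_elt.
have [-> _] := meet_neq_bot xyz.
by move: xyz; rewrite -meetA => /meet_neq_bot[_ ->]; rewrite !andbT andbA.
Qed.

Lemma bmmulC x y : bmmul x y = bmmul y x.
Proof. by rewrite /bmmul meetC andbC. Qed.

Lemma bmmul1r x : bmmul bmone x = x.
Proof.
rewrite /bmmul level_elt bit_elt meet1x -[RHS]eltK; apply: eq_elt => // x0.
by rewrite (top_neq_bot x0).
Qed.

Lemma bmmulDr x y z :
  bmmul x (bmadd y z) = bmadd (bmmul x y) (bmmul x z).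
Proof.
apply: eq_elt; rewrite !level_elt; first by rewrite meetACA meetxx.
(* Doubling level x makes the level of each product x * y, x * z appear as an
   argument of the meet; undoing it below does the same for the sum y + z. *)
rewrite -{1}[level x]meetxx meetACA => xyz; rewrite !bit_elt.
have [-> ->] := meet_neq_bot xyz.
move: xyz; rewrite meetACA => /meet_neq_bot[_ ->].
by rewrite !andbT andb_addr.
Qed.

Lemma bmmul0D x y :
  bmmul bmzero (bmadd x y) = bmadd (bmmul bmzero x) (bmmul bmzero y).
Proof. exact: bmmulDr. Qed.

HB.instance Definition _ := isPreMeadow.Build bit_meadow
  bmaddA bmaddC bmaddr0 bmaddrN bmmulA bmmulC bmmul1r bmmulDr
  (fun=> erefl) bmmul0D.

Lemma bm_addE x y :
  x + y = elt (Order.meet (level x) (level y)) (bit x (+) bit y).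
Proof. by []. Qed.

Lemma bm_mulE x y :
  x * y = elt (Order.meet (level x) (level y)) (bit x && bit y).
Proof. by []. Qed.

Lemma bm_mul0 x : 0 * x = elt (level x) false.
Proof. by rewrite bm_mulE level_elt bit_elt meet1x. Qed.

Definition bmbot := elt \bot%O false.

Lemma elt_bot b : elt \bot%O b = bmbot.
Proof. by apply: eq_elt => //; rewrite eqxx. Qed.

(** The fibre over the zero of a level is the ring at that level, which has two
    elements except at the bottom. *)
Lemma bmbot_unique :
  unique (fun z : bit_meadow => in_zeroP z /\ singleton_fibre z) bmbot.
Proof.
have zeroE l b : 0 * elt l b = elt l false by rewrite bm_mul0 level_elt.
split.
  split; first by exists bmbot; rewrite zeroE.
  exists bmbot; split=> [|x]; first exact: zeroE.
  rewrite /fibre bm_mul0 => /(congr1 level); rewrite !level_elt => x0.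
  by rewrite -[x]eltK x0 elt_bot.
move=> z [[x ->]]; rewrite bm_mul0; set l := level x => -[y [_ yU]].
have [-> //|l0] := eqVneq l \bot%O.
(* Away from the bottom the fibre contains both bits, so it is no singleton. *)
have /(congr1 bit) : elt l true = elt l false.
  by rewrite -(yU (elt l true)) 1?(yU (elt l false)) //; apply: zeroE.
by rewrite !bit_elt l0.
Qed.

Lemma bmadd_bot x : x + bmbot = bmbot.
Proof. by rewrite bm_addE level_elt meetx0 elt_bot. Qed.

HB.instance Definition _ :=
  PreMeadow_hasBot.Build bit_meadow bmbot_unique bmadd_bot.

Definition bminv x := if bit x then x else bmbot.

Lemma bmmul_bot x : x * bmbot = bmbot.
Proof. by rewrite bm_mulE level_elt meetx0 elt_bot. Qed.

Lemma bminv_elt l : bminv (elt l true) = elt l true.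
Proof.
rewrite /bminv bit_elt; case: eqVneq => [->|//].
by rewrite elt_bot.
Qed.

Lemma elt1D0 x : 1 + 0 * x = elt (level x) true.
Proof.
rewrite bm_mul0 bm_addE !level_elt !bit_elt meet1x addbF.
by apply: eq_elt => // /top_neq_bot.
Qed.

Lemma bmmulrV x : x * bminv x = 1 + 0 * bminv x.
Proof.
rewrite elt1D0 /bminv; case: ifP => bx; last first.
  by rewrite bmmul_bot level_elt elt_bot.
by rewrite bm_mulE meetxx bx.
Qed.

Lemma bminvM x y : bminv (x * y) = bminv x * bminv y.
Proof.
have [bx|bx] := boolP (bit x); last first.
  by rewrite /bminv bit_elt (negPf bx) [RHS]mmulC bmmul_bot.
have [by_|by_] := boolP (bit y); last first.
  by rewrite /bminv bit_elt (negPf by_) andbF bmmul_bot.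
by rewrite bm_mulE bx by_ bminv_elt /bminv bx by_ bm_mulE bx by_.
Qed.

Lemma bminv1D0 x : bminv (1 + 0 * x) = 1 + 0 * x.
Proof. by rewrite elt1D0 bminv_elt. Qed.

Lemma bminv0 : bminv 0 = mbot.
Proof. by rewrite /bminv bit_elt. Qed.

HB.instance Definition _ := PreMeadowBot_isCommonMeadow.Build bit_meadow
  bmmulrV bminvM bminv1D0 bminv0.

Lemma card_bit_meadow : #|{: bit_meadow}| = (2 * #|L|).-1.
Proof.
rewrite card_sig mulnC -card_bool -card_prod.
rewrite [in RHS](cardD1 (\bot%O : L, true)) add1n /=.
apply: eq_card => -[l b]; rewrite !inE xpair_eqE /=.
by case: b; rewrite ?andbT ?andbF.
Qed.

End BitMeadow.

(** * Recovering the lattice *)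

(** The zeros of the levels are the elements [0 * x], and addition restricts to
    the meet on them; both are invariant under isomorphism. *)
Lemma bit_meadow_iso d1 (L1 : finTBLatticeType d1) d2 (L2 : finTBLatticeType d2) :
  meadow_isomorphic (bit_meadow L1) (bit_meadow L2) ->
  exists2 g : L1 -> L2, bijective g & {mono g : l m / (l <= m)%O}.
Proof.
case=> f [[f' fK f'K] [[f0 _] [fD fM _ _]]].
pose g (l : L1) := level (f (elt l false)).
have fg l : f (elt l false) = elt (g l) false.
  rewrite -[RHS]bm_mul0 -f0 -fM; congr f.
  by rewrite bm_mul0 level_elt.
have gI : {morph g : l m / Order.meet l m}.
  move=> l m; rewrite /g.
  have -> : elt (Order.meet l m) false = madd (elt l false) (elt m false).
    by rewrite bm_addE !level_elt !bit_elt.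
  by rewrite fD bm_addE level_elt.
have g_inj : injective g.
  move=> l m gE; have : elt l false = elt m false.
    by apply: (can_inj fK); rewrite !fg gE.
  by move/(congr1 (@level _ _)); rewrite !level_elt.
have g_onto m : g (level (f' (elt m false))) = m.
  rewrite /g -[elt (level _) _]bm_mul0 fM f'K f0 bm_mul0.
  by rewrite !level_elt.
exists g.
  exists (fun m => level (f' (elt m false))) => // l.
  by apply: g_inj; rewrite g_onto.
by move=> l m; rewrite !leEmeet -gI (inj_eq g_inj).
Qed.

(** * Choosing one lattice in each isomorphism class *)

(** The construction above uses the bottom and the top, which a finite nonempty
    lattice has as the meet and the join of all its elements. *)
Lemma finTBLattice_realized m (r : {set 'I_m.+1 * 'I_m.+1}) :
  r \in lattice_orders m.+1 ->
  exists (d : Order.disp_t) (T : finTBLatticeType d) (f : T -> 'I_m.+1),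
    bijective f /\ forall x y, rle r (f x) (f y) = (x <= y)%O.
Proof.
move=> /lattice_order_realized[d [T [f [[h fK hK] fE]]]].
pose x0 := h ord0.
pose lo : T := foldr Order.meet x0 (enum T).
pose hi : T := foldr Order.join x0 (enum T).
have lo_le x : (lo <= x)%O.
  have : x \in enum T by rewrite mem_enum.
  rewrite /lo; elim: (enum T) => //= y s IHs; rewrite inE.
  by case/predU1P=> [->|/IHs xs]; rewrite ?leIl // leIx2 // xs orbT.
have le_hi x : (x <= hi)%O.
  have : x \in enum T by rewrite mem_enum.
  rewrite /hi; elim: (enum T) => //= y s IHs; rewrite inE.
  by case/predU1P=> [->|/IHs xs]; rewrite ?leUl // lexU2 // xs orbT.
pose bmix := @Order.hasBottom.Build d T lo lo_le.
pose tmix := @Order.hasTop.Build d T hi le_hi.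
pose L : finTBLatticeType d := HB.pack (Order.FinLattice.sort T) bmix tmix.
by exists d, L, f; split=> //; exists h.
Qed.

Lemma lattice_representatives m :
  exists r : 'I_(num_lattices m) -> {set 'I_m * 'I_m},
    (forall i, r i \in lattice_orders m) /\
    (forall i j, lattice_iso (r i) (r j) -> i = j).
Proof.
have eqR := @lattice_iso_equivalence m.
have [/eqP covP trivP P0] := and3P (equivalence_partitionP eqR).
have /fin_all_exists[r rP] (i : 'I_(num_lattices m)) :
    exists x : {set 'I_m * 'I_m}, x \in (enum_val i : {set _}).
  by apply/set0Pn; apply: contraNneq P0 => <-; apply: enum_valP.
have rL i : r i \in lattice_orders m.
  by rewrite -covP; apply/bigcupP; exists (enum_val i); first exact: enum_valP.
exists r; split=> // i j; rewrite -(pblock_equivalence_partition eqR) //.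
rewrite -eq_pblock // ?covP // => /eqP eqij; apply: enum_val_inj.
by rewrite -(def_pblock trivP (enum_valP i) (rP i)) eqij
  (def_pblock trivP (enum_valP j) (rP j)).
Qed.

(** * Counting common meadows *)

Theorem proposition3p4 (n : nat) (hn : 1 <= n) :
  exists M : 'I_(num_lattices n.+1) -> finCommonMeadowType,
    (forall i, #|M i| = (2 * n).+1) /\
    (forall i j, i <> j -> ~ meadow_isomorphic (M i) (M j)).
Proof.
have [r [rL r_inj]] := lattice_representatives n.+1.
have /fin_all_exists[M MP] i : exists M : finCommonMeadowType,
    exists (d : Order.disp_t) (T : finTBLatticeType d) (f : T -> 'I_n.+1),
    [/\ M = bit_meadow T, bijective f &
        forall x y, rle (r i) (f x) (f y) = (x <= y)%O].
  have [d [T [f [f_bij fE]]]] := finTBLattice_realized (rL i).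
  by exists (bit_meadow T), d, T, f.
exists M; split=> [i|i j ij].
  have [d [T [f [-> f_bij _]]]] := MP i.
  by rewrite card_bit_meadow (bij_eq_card f_bij) card_ord mulnS.
have [d1 [T1 [f1 [-> [h1 f1K h1K] f1E]]]] := MP i.
have [d2 [T2 [f2 [-> f2_bij f2E]]]] := MP j.
(* The order isomorphism, transported along the two enumerations, is the
   permutation of the indices required by lattice_iso. *)
case/bit_meadow_iso=> g g_bij gE; apply: ij; apply: r_inj.
have s_inj : injective (f2 \o g \o h1).
  by apply: inj_comp (can_inj h1K); apply: bij_inj; apply: bij_comp.
apply/lattice_isoP; exists (perm s_inj) => x y.
by rewrite !permE /= f2E gE -f1E !h1K.
Qed.
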